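(* Let $\mathcal{W}=\boldsymbol{w}_1\otimes\cdots\otimes\boldsymbol{w}_n\in\mathbb{R}^{d_1\times\cdots\times d_n}$ (outer product of vectors $\boldsymbol{w}_k\in\mathbb{R}^{d_k}$) have strictly positive entries, and fix a nonempty set $\Omega\subseteq[d_1]\times\cdots\times[d_n]$. Let $\mathcal{T}\in\mathbb{R}^{d_1\times\cdots\times d_n}$ be a fixed tensor, let $\sigma>0$, and let $\mathcal{Z}\in\mathbb{R}^{d_1\times\cdots\times d_n}$ be a random tensor with i.i.d. entries $\mathcal{Z}_{i_1\cdots i_n}\sim\mathcal{N}(0,\sigma^2)$. Put $\mathcal{Y}_\Omega=\boldsymbol{1}_\Omega\boxdot(\mathcal{T}+\mathcal{Z})$. Suppose that one of the following two situations holds. (i) $\mathcal{T}$ has CP rank $r$, and $\widehat{\mathcal{T}}$ is an optimal solution $$\widehat{\mathcal{T}}=\mathcal{W}^{(-1/2)}\boxdot\underset{\operatorname{rank}(\mathcal{X})=r}{\operatorname{argmin}}\left\|\mathcal{X}-\mathcal{W}^{(-1/2)}\boxdot\mathcal{Y}_\Omega\right\|_F,$$ the minimum being over tensors $\mathcal{X}\in\mathbb{R}^{d_1\times\cdots\times d_n}$ of CP rank $r$. (ii) $\mathcal{T}$ has Tucker rank $\boldsymbol{r}=[r_1,\dots,r_n]$, and $\widehat{\mathcal{T}}$ is an optimal solution $$\widehat{\mathcal{T}}=\mathcal{W}^{(-1/2)}\boxdot\underset{\text{Tucker-rank}(\mathcal{X})=\boldsymbol{r}}{\operatorname{argmin}}\left\|\mathcal{X}-\mathcal{W}^{(-1/2)}\boxdot\mathcal{Y}_\Omega\right\|_F,$$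 the minimum being over tensors $\mathcal{X}\in\mathbb{R}^{d_1\times\cdots\times d_n}$ of Tucker rank $\boldsymbol{r}$. Then with probability at least $1-2^{-|\Omega|/2}$ over the choice of $\mathcal{Z}$, $$\left\|\mathcal{W}^{(1/2)}\boxdot(\mathcal{T}-\widehat{\mathcal{T}})\right\|_F\leq 2\|\mathcal{T}\|_\infty\left\|\mathcal{W}^{(1/2)}-\mathcal{W}^{(-1/2)}\boxdot\boldsymbol{1}_\Omega\right\|_F+4\sigma\mu\sqrt{|\Omega|\log(2)},$$ where $\mu^2=\max_{(i_1,\dots,i_n)\in\Omega}\frac{1}{\mathcal{W}_{i_1\cdots i_n}}$.
   Context: Notation. $[d]=\{1,\dots,d\}$. $\boldsymbol{1}_\Omega\in\mathbb{R}^{d_1\times\cdots\times d_n}$ is the tensor with entries $1$ on $\Omega$ and $0$ elsewhere. $\boxdot$ is the entrywise (Hadamard) product. For real $\alpha$, $\mathcal{X}^{(\alpha)}$ is the entrywise power: $(\mathcal{X}^{(\alpha)})_{i_1\cdots i_n}=\mathcal{X}_{i_1\cdots i_n}^{\alpha}$. $\|\mathcal{X}\|_F=(\sum\mathcal{X}_{i_1\cdots i_n}^2)^{1/2}$ and $\|\mathcal{X}\|_\infty=\max|\mathcal{X}_{i_1\cdots i_n}|$. The outer product is $(\boldsymbol{a}_1\otimes\cdots\otimes\boldsymbol{a}_n)_{i_1\cdots i_n}=\prod_k\boldsymbol{a}_k(i_k)$. The CP rank, $\operatorname{rank}(\mathcal{X})$, is the smallest number of rank-one tensors (outer products of $n$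 vectors) whose sum is $\mathcal{X}$. The mode-$k$ unfolding $\mathcal{X}_{(k)}\in\mathbb{R}^{d_k\times\prod_{j\ne k}d_j}$ is the matrix whose columns are the vectors obtained from $\mathcal{X}$ by fixing all indices except the $k$-th. The Tucker rank of $\mathcal{X}$ is $(r_1,\dots,r_n)$ with $r_k=\operatorname{rank}(\mathcal{X}_{(k)})$. ''Optimal solution'' means that $\widehat{\mathcal{T}}=\mathcal{W}^{(-1/2)}\boxdot\widehat{\mathcal{X}}$, where $\widehat{\mathcal{X}}$ attains the minimum (it is assumed that an optimal solution exists). *)

(* Defs.v *)
From HB Require Import structures.
From mathcomp Require Export all_boot all_order all_algebra.
From mathcomp Require Export all_classical all_reals all_analysis.

Set Implicit Arguments.
Unset Strict Implicit.
Unset Printing Implicit Defensive.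

Import Order.TTheory GRing.Theory Num.Theory.

Local Open Scope classical_set_scope.
Local Open Scope ring_scope.

Notation index d := {dffun forall k : 'I_ _, 'I_(d k)}.
Notation tensor R d := {ffun index d -> R}.

Section Tensors.
Context {R : realType} {n : nat} {d : 'I_n -> nat}.
Implicit Types (X Y W : tensor R d) (D : {set index d}).

Definition hadamard X Y : tensor R d := [ffun i => X i * Y i].

(* [powR] is the usual real power on positive reals only; [tpow] is meant for
   entrywise positive tensors. *)
Definition tpow X (a : R) : tensor R d := [ffun i => X i `^ a].

Definition tindic D : tensor R d := [ffun i => (i \in D)%:R].

Definition fnorm X : R := Num.sqrt (\sum_i X i ^+ 2).

Definition supnorm X : R := \big[Num.max/0]_i `|X i|.

Definition outer (a : forall k : 'I_n, 'rV[R]_(d k)) : tensor R d :=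
  [ffun i : index d => \prod_(k < n) a k 0 (i k)].

Definition sum_of_rank_ones X (r : nat) : Prop :=
  exists a : 'I_r -> forall k : 'I_n, 'rV[R]_(d k),
    X = \sum_(s < r) outer (a s).

Definition has_cp_rank X (r : nat) : Prop :=
  sum_of_rank_ones X r /\
  (forall s : nat, sum_of_rank_ones X s -> (r <= s)%N).

(* A choice of all the coordinates but the [k]-th: it labels a column of the
   mode-[k] unfolding. *)
Definition fiber (k : 'I_n) := {dffun forall j : {j | k != j}, 'I_(d (val j))}.

Definition fill (k : 'I_n) (x : 'I_(d k)) (c : fiber k) : index d :=
  [ffun j => match @eqP _ k j with
             | ReflectT e => ecast l 'I_(d l) e x
             | ReflectF ne => c (exist _ j (contra_not_neq id ne))
             end].

(* The columns are listed in the order in which the finite type [fiber k] is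
   enumerated; the rank does not depend on this order. *)
Definition unfolding (k : 'I_n) X : 'M[R]_(d k, #|{: fiber k}|) :=
  \matrix_(x, c) X (fill x (enum_val c)).

Definition tucker_rank X : {ffun 'I_n -> nat} :=
  [ffun k => \rank (unfolding k X)].

Definition is_minimizer (C : set (tensor R d)) (f : tensor R d -> R) X : Prop :=
  C X /\ (forall X', C X' -> f X <= f X').

Definition optimal_solution W Y (C : set (tensor R d)) (That : tensor R d)
    : Prop :=
  exists2 Xhat : tensor R d,
    is_minimizer C (fun X => fnorm (X - hadamard (tpow W (- 2^-1)) Y)) Xhat &
    That = hadamard (tpow W (- 2^-1)) Xhat.

(* [mu ^+ 2] is the maximum of [(W i)^-1] over [D]; the default value [0] plays
   no role when [D] is nonempty and [W] is entrywise positive. *)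
Definition mu W D : R := Num.sqrt (\big[Num.max/0]_(i in D) (W i)^-1).

End Tensors.

Arguments fiber {n} d k.

Section RandomTensors.
Context {R : realType} {d0 : measure_display} {S : measurableType d0}.
Context (P : probability S R).

Definition mutually_independent (I : finType) (X : I -> {RV P >-> R}) : Prop :=
  forall (J : {set I}) (A : I -> set R), (forall i, measurable (A i)) ->
    P (\bigcap_(i in [set` J]) (X i @^-1` A i)) =
    (\prod_(i in J) P (X i @^-1` A i))%E.

Definition iid_normal (I : finType) (X : I -> {RV P >-> R}) (sigma : R) : Prop :=
  mutually_independent X /\
  (forall i (A : set R), measurable A ->
     distribution P (X i) A = normal_prob 0 sigma A).

Definition sample {n : nat} {d : 'I_n -> nat} (Z : index d -> {RV P >-> R})
    (s : S) : tensor R d := [ffun i => Z i s].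

End RandomTensors.

(* Main.v *)
From HB Require Import structures.
Require Import Defs.
From mathcomp Require Import ring measurable_realfun.
Import Order.TTheory GRing.Theory Num.Theory.
Local Open Scope classical_set_scope.
Local Open Scope ring_scope.

(* Multiplying by the positive rank-one tensor [W^(1/2)] preserves both ranks, so
   [W^(1/2) T] competes with [Xhat] and, by the triangle inequality, lies within
   twice its own distance to [W^(-1/2) Y] of it.  That distance splits into the
   deterministic term and a noise term of norm at most [mu |1_Omega Z|].  The
   noise is a chi-square tail: with [lambda = 3 / (8 sigma^2)] a centred Gaussian
   satisfies [E exp(lambda z^2) = (1 - 2 lambda sigma^2)^(-1/2) = 2], hence, with
   [m = #|Omega|],
   [P (sum z_i^2 >= 4 sigma^2 m ln 2) <= 2^m exp(- 3/2 m ln 2) = 2^(-m/2)]. *)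

(** * Frobenius norm and the deterministic error bound *)

Section Norms.
Context {R : realType} {n : nat} {d : 'I_n -> nat}.
Implicit Types (X Y W B T N : tensor R d) (D : {set index d}).
Implicit Types (C : set (tensor R d)).

Lemma fnorm_ge0 X : 0 <= fnorm X.
Proof. exact: sqrtr_ge0. Qed.

Lemma sqr_fnorm X : fnorm X ^+ 2 = \sum_i X i ^+ 2.
Proof. by rewrite sqr_sqrtr// sumr_ge0// => i _; exact: sqr_ge0. Qed.

Lemma fnorm_eq0 X : fnorm X = 0 -> X = 0.
Proof.
move=> X0; apply/ffunP => i; rewrite [RHS]ffunE.
have /eqP := sqr_fnorm X; rewrite X0 expr0n/= eq_sym psumr_eq0; last first.
  by move=> j _; exact: sqr_ge0.
by move=> /allP/(_ i); rewrite mem_index_enum sqrf_eq0 => /(_ isT)/eqP.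
Qed.

(** Squaring leaves Cauchy-Schwarz, whose doubled gap is a sum of squares once scaled by
    [fnorm X * fnorm Y]; zero norms are set aside first for that scaling. *)
Lemma fnormD X Y : fnorm (X + Y) <= fnorm X + fnorm Y.
Proof.
have [/fnorm_eq0 ->|X0] := eqVneq (fnorm X) 0.
  by rewrite add0r lerDr fnorm_ge0.
have [/fnorm_eq0 ->|Y0] := eqVneq (fnorm Y) 0.
  by rewrite addr0 lerDl fnorm_ge0.
have Xp : 0 < fnorm X by rewrite lt_def X0 fnorm_ge0.
have Yp : 0 < fnorm Y by rewrite lt_def Y0 fnorm_ge0.
rewrite -ler_sqr ?nnegrE ?addr_ge0 ?fnorm_ge0// sqrrD !sqr_fnorm.
rewrite (eq_bigr (fun i => X i ^+ 2 + (X i * Y i) *+ 2 + Y i ^+ 2)); last first.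
  by move=> i _; rewrite ffunE sqrrD.
rewrite big_split [X in X + _ <= _]big_split/= sumrMnl lerD2r lerD2l lerMn2r/=.
rewrite -(ler_pM2l (mulr_gt0 Xp Yp)) -(@ler_pMn2r _ 2)//.
rewrite mulr_sumr -subr_ge0.
have -> : fnorm X * fnorm Y * (fnorm X * fnorm Y) *+ 2
    = \sum_i ((fnorm Y * X i) ^+ 2 + (fnorm X * Y i) ^+ 2).
  rewrite big_split/=.
  under eq_bigr do rewrite exprMn.
  under [X in _ = _ + X]eq_bigr do rewrite exprMn.
  by rewrite -!mulr_sumr -!sqr_fnorm; ring.
rewrite -sumrMnl -sumrB sumr_ge0// => i _.
rewrite [X in 0 <= X](_ : _ = (fnorm Y * X i - fnorm X * Y i) ^+ 2) ?sqr_ge0//.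
by ring.
Qed.

Lemma fnormN X : fnorm (- X) = fnorm X.
Proof. by congr Num.sqrt; apply: eq_bigr => i _; rewrite ffunE sqrrN. Qed.

Lemma fnorm_hadamard_le X Y (c : R) :
  0 <= c -> (forall i, `|X i| <= c) -> fnorm (hadamard X Y) <= c * fnorm Y.
Proof.
move=> c0 Xc; rewrite -ler_sqr ?nnegrE ?mulr_ge0 ?fnorm_ge0//.
rewrite exprMn !sqr_fnorm mulr_sumr ler_sum// => i _.
rewrite ffunE exprMn ler_wpM2r ?sqr_ge0//.
by rewrite -(real_normK (num_real (X i))) ler_sqr ?nnegrE.
Qed.

Lemma le_supnorm T i : `|T i| <= supnorm T.
Proof. exact: le_bigmax. Qed.

Lemma supnorm_ge0 T : 0 <= supnorm T.
Proof. exact: bigmax_ge_id. Qed.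

(** [X] itself competes, so [Xhat] is no farther from [B] than [X] is; the triangle inequality
    through [B] doubles that distance. *)
Lemma minimizer_fnorm_le C B X Xhat :
  is_minimizer C (fun X => fnorm (X - B)) Xhat -> C X ->
  fnorm (X - Xhat) <= 2 * fnorm (X - B).
Proof.
move=> [_ Xmin] /Xmin/= XB; rewrite -[X - Xhat](subrKA B).
apply: le_trans (fnormD _ _) _.
by rewrite -[B - Xhat]opprB fnormN mulr_natl mulr2n lerD2l.
Qed.

Lemma tpowV W (a : R) : (forall i, 0 < W i) ->
  hadamard (tpow W a) (tpow W (- a)) = [ffun=> 1].
Proof.
move=> W0; apply/ffunP => i; rewrite !ffunE -powRD ?subrr ?powRr0//.
by rewrite eqxx gt_eqF.
Qed.

Lemma tpow_indic_le_mu W D i : (forall i, 0 < W i) ->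
  `|hadamard (tpow W (- 2^-1)) (tindic D) i| <= mu W D.
Proof.
move=> W0; rewrite !ffunE; case: (boolP (i \in D)) => iD; last first.
  by rewrite mulr0 normr0 sqrtr_ge0.
rewrite mulr1 ger0_norm ?powR_ge0// powRN powR12_sqrt ?(ltW (W0 _))//.
rewrite -sqrtrV; last exact: ltW.
apply: ler_wsqrtr; exact: (le_bigmax_cond _ (fun j => (W j)^-1) iD).
Qed.

(** The part free of randomness: [N] is any tensor and [C] any set containing the rescaled [T].
    Multiplying by [W^(1/2)] turns [That] back into [Xhat]. *)
Lemma optimal_solution_fnorm_le W D T N C That :
  (forall i, 0 < W i) -> C (hadamard (tpow W 2^-1) T) ->
  optimal_solution W (hadamard (tindic D) (T + N)) C That ->
  fnorm (hadamard (tpow W 2^-1) (T - That)) <=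
    2 * supnorm T *
      fnorm (tpow W 2^-1 - hadamard (tpow W (- 2^-1)) (tindic D))
    + 2 * mu W D * fnorm (hadamard (tindic D) N).
Proof.
move=> W0 CT [Xhat Xmin ->].
have -> : hadamard (tpow W 2^-1) (T - hadamard (tpow W (- 2^-1)) Xhat) =
    hadamard (tpow W 2^-1) T - Xhat.
  apply/ffunP => i; have /ffunP/(_ i) := tpowV W 2^-1 W0.
  by rewrite !ffunE mulrBr mulrA => ->; rewrite mul1r.
apply: le_trans (minimizer_fnorm_le _ _ _ _ Xmin CT) _.
(* The idempotent mask is used twice in the noise term: one copy lets [mu] bound [W^(-1/2)] on [D],
   the other keeps the noise confined to [D]. *)
have -> : hadamard (tpow W 2^-1) T -
    hadamard (tpow W (- 2^-1)) (hadamard (tindic D) (T + N)) =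
    hadamard T (tpow W 2^-1 - hadamard (tpow W (- 2^-1)) (tindic D)) +
    - hadamard (hadamard (tpow W (- 2^-1)) (tindic D)) (hadamard (tindic D) N).
  apply/ffunP => i; rewrite !ffunE.
  by case: (boolP (i \in D)) => _; rewrite ?mulr1 ?mulr0 ?mul1r ?mul0r; ring.
rewrite -!mulrA -mulrDr ler_pM2l//.
apply: le_trans (fnormD _ _) _; rewrite fnormN lerD//.
  apply: fnorm_hadamard_le => [|i]; [exact: supnorm_ge0|exact: le_supnorm].
apply: fnorm_hadamard_le => [|i]; first exact: sqrtr_ge0.
exact: tpow_indic_le_mu.
Qed.

End Norms.

(** * Ranks under entrywise multiplication by a rank-one tensor *)

Section Ranks.
Context {R : realType} {n : nat} {d : 'I_n -> nat}.
Implicit Types (X : tensor R d) (a b : forall k : 'I_n, 'rV[R]_(d k)).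

Lemma hadamard_outer a b :
  hadamard (outer a) (outer b) = outer (fun k => \row_x (a k 0 x * b k 0 x)).
Proof.
apply/ffunP => i; rewrite !ffunE -big_split/=.
by apply: eq_bigr => k _; rewrite mxE.
Qed.

(** The factor is absorbed into each rank-one term, vector by vector. *)
Lemma sum_of_rank_ones_hadamard a X s :
  sum_of_rank_ones X s -> sum_of_rank_ones (hadamard (outer a) X) s.
Proof.
move=> [b ->]; exists (fun t k => \row_x (a k 0 x * b t k 0 x)).
rewrite -(eq_bigr _ (fun t _ => hadamard_outer a (b t))).
apply/ffunP => i; rewrite ffunE !sum_ffunE mulr_sumr.
by apply: eq_bigr => t _; rewrite !ffunE.
Qed.

Lemma fill_eq k x (c : fiber d k) : fill x c k = x.
Proof.
rewrite ffunE; case: eqP => // e.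
by rewrite (eq_irrelevance e erefl).
Qed.

Lemma fill_neq k x y (c : fiber d k) j : k != j -> fill x c j = fill y c j.
Proof. by move=> kj; rewrite !ffunE; case: eqP => // e; rewrite e eqxx in kj. Qed.

(** Mode [k] sees the factor as a row scaling by [a k] and a column scaling by the product of the
    other vectors; matrix products cannot raise the rank. *)
Lemma rank_unfolding_hadamard_le a X k :
  (\rank (unfolding k (hadamard (outer a) X)) <= \rank (unfolding k X))%N.
Proof.
(* The column weight ignores coordinate [k], so any [x] serves to build an index. The default [1]
   occurs only when [d k = 0], where the matrix has no rows. *)
pose b (c : fiber d k) : R :=
  oapp (fun x => \prod_(j | j != k) a j 0 (fill x c j)) 1 [pick x : 'I_(d k)].
have -> : unfolding k (hadamard (outer a) X) =
    diag_mx (a k) *m unfolding k X *m diag_mx (\row_c b (enum_val c)).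
  apply/matrixP => x c; rewrite mul_mx_diag mul_diag_mx !mxE !ffunE.
  rewrite (bigD1 k)//= fill_eq mulrAC; congr (_ * _ * _).
  rewrite /b; case: pickP => [y _|/(_ x)//]/=.
  by apply: eq_bigr => j jk; rewrite (fill_neq _ x y) 1?eq_sym.
by rewrite (leq_trans (mxrankM_maxl _ _))// mxrankM_maxr.
Qed.

Section Invertible.
Context {a b : forall k : 'I_n, 'rV[R]_(d k)}.
Hypothesis ab1 : hadamard (outer a) (outer b) = [ffun=> 1].

Lemma hadamard_outerK X : hadamard (outer b) (hadamard (outer a) X) = X.
Proof.
apply/ffunP => i; have /ffunP/(_ i) := ab1.
by rewrite !ffunE mulrA [_ * \prod_(k < n) a _ _ _]mulrC => ->; rewrite mul1r.
Qed.

(** Minimality transfers back: multiplying by [outer b] turns a decomposition of the product into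
    one of [X] with as many terms. *)
Lemma has_cp_rank_hadamard X r :
  has_cp_rank X r -> has_cp_rank (hadamard (outer a) X) r.
Proof.
move=> [Xr rmin]; split; first exact: sum_of_rank_ones_hadamard.
move=> s /(sum_of_rank_ones_hadamard b); rewrite hadamard_outerK.
exact: rmin.
Qed.

(** The rank inequality is used twice, for [a] and for its inverse [b]. *)
Lemma tucker_rank_hadamard X : tucker_rank (hadamard (outer a) X) = tucker_rank X.
Proof.
apply/ffunP => k; rewrite !ffunE; apply/eqP.
rewrite eqn_leq rank_unfolding_hadamard_le/=.
by rewrite -{1}[X]hadamard_outerK rank_unfolding_hadamard_le.
Qed.

End Invertible.

(** Positive products do not force each vector to be positive, hence the absolute values; they leave
    the products unchanged. *)
Lemma tpow_outer a (p : R) :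
  (forall i, 0 < outer a i) ->
  tpow (outer a) p = outer (fun k => \row_x (`|a k 0 x| `^ p)).
Proof.
move=> a0; apply/ffunP => i; rewrite [LHS]ffunE -(ger0_norm (ltW (a0 i))) !ffunE.
rewrite normr_prod; under [RHS]eq_bigr do rewrite mxE.
(* Nonnegativity of the partial product is carried through the induction because [powRM] asks for
   it. *)
have [_ ->] // : 0 <= \prod_(k < n) `|a k 0 (i k)| /\
    (\prod_(k < n) `|a k 0 (i k)|) `^ p = \prod_(k < n) (`|a k 0 (i k)| `^ p).
elim/big_rec2 : _ => [|k x y _ [y0 <-]]; first by rewrite powR1.
by rewrite mulr_ge0// powRM.
Qed.

End Ranks.

(** * The rescaled target satisfies the rank constraint *)

Section Feasibility.
Context {R : realType} {n : nat} {d : 'I_n -> nat}.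

(** The powers [p] and [- p] of [outer a] are both outer products and mutually inverse, so the
    invertible case applies. *)
Lemma has_cp_rank_tpow_outer (a : forall k : 'I_n, 'rV[R]_(d k)) p T r :
  (forall i, 0 < outer a i) -> has_cp_rank T r ->
  has_cp_rank (hadamard (tpow (outer a) p) T) r.
Proof.
move=> a0; have := tpowV (outer a) p a0; rewrite !tpow_outer// => ab1.
exact: has_cp_rank_hadamard ab1 _ _.
Qed.

Lemma tucker_rank_tpow_outer (a : forall k : 'I_n, 'rV[R]_(d k)) p T :
  (forall i, 0 < outer a i) ->
  tucker_rank (hadamard (tpow (outer a) p) T) = tucker_rank T.
Proof.
move=> a0; have := tpowV (outer a) p a0; rewrite !tpow_outer// => ab1.
exact: tucker_rank_hadamard ab1 _.
Qed.

End Feasibility.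

(** * Integrals of a composition against a weight *)

Section CompMul.
Context {R : realType}.
Implicit Types g : R -> R.

Import HBNNSimple.

Let approx g (mg : measurable_fun setT g) :=
  nnsfun_approx measurableT ((measurable_EFinP setT g).2 mg).

(** Monotone convergence along simple functions increasing to [g]; each simple integral splits over
    the finitely many values taken. *)
Let integral_comp_mul_lim {d0 : measure_display} {S : measurableType d0}
    (mu : {measure set S -> \bar R}) (X h : S -> R) g
    (mg : measurable_fun setT g) :
  measurable_fun setT X -> measurable_fun setT h ->
  (forall s, 0 <= h s) -> (forall x, 0 <= g x) ->
  (\int[mu]_s (g (X s) * h s)%:E = limn (fun m =>
     \sum_(y \in range (approx g mg m))
        (y%:E * \int[mu]_s (\1_(approx g mg m @^-1` [set y]) (X s) * h s)%:E)))%E.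
Proof.
move=> mX mh h0 g0; set a := approx g mg.
have ma m : measurable_fun setT (fun s => (a m (X s) * h s)%:E).
  apply/measurable_EFinP/measurable_funM => //.
  exact: (measurableT_comp (measurable_funPT (a m)) mX).
transitivity (limn (fun m => \int[mu]_s (a m (X s) * h s)%:E)%E).
  rewrite -monotone_convergence//; last 2 first.
  - by move=> m s _; rewrite lee_fin mulr_ge0.
  - move=> s _ m1 m2 m12; rewrite lee_fin ler_wpM2r//.
    exact/lefP/nd_nnsfun_approx.
  apply: eq_integral => s _; apply/esym/cvg_lim => //.
  under eq_fun do rewrite EFinM.
  rewrite EFinM; apply: cvgeZr => //.
  apply: (cvg_nnsfun_approx measurableT ((measurable_EFinP setT g).2 mg)) => //.
  by move=> x _; rewrite lee_fin.
congr (limn _); apply/funext => m.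
have mind y : measurable_fun setT
    (fun s => (\1_(a m @^-1` [set y]) (X s) * h s)%:E).
  apply/measurable_EFinP/measurable_funM => //.
  by apply: (measurableT_comp _ mX); exact: measurable_indic.
have y0 y : y \in range (a m) -> 0 <= y by rewrite inE => -[x _ <-].
transitivity (\int[mu]_s (\sum_(y \in range (a m))
    (y%:E * (\1_(a m @^-1` [set y]) (X s) * h s)%:E)))%E.
  apply: eq_integral => s _; rewrite fsbig_finite//=.
  under eq_bigr do rewrite -EFinM mulrA.
  by rewrite sumEFin -mulr_suml -fsbig_finite// -fimfunE.
rewrite ge0_integral_fsum//; last 2 first.
- by move=> y; exact: measurable_funeM.
- move=> y s; rewrite -EFinM lee_fin.
  have [yr|yr] := boolP (y \in range (a m)).
    by rewrite !mulr_ge0// y0.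
  (* A value outside the range has empty preimage, so its sign does not matter. *)
  rewrite indicE memNset ?mul0r ?mulr0//= => e.
  by move: yr => /negP; apply; rewrite inE; exists (X s).
apply: eq_fsbigr => y yr; rewrite ge0_integralZl//.
- by move=> s _; rewrite lee_fin mulr_ge0.
- by rewrite lee_fin y0.
Qed.

(* Both sides are limits of the same combinations of the integrals in the last
   hypothesis: approximate [g] by simple functions. *)
Lemma eq_integral_comp_mul {d1 d2 : measure_display}
    {S1 : measurableType d1} {S2 : measurableType d2}
    (mu1 : {measure set S1 -> \bar R}) (mu2 : {measure set S2 -> \bar R})
    (X1 h1 : S1 -> R) (X2 h2 : S2 -> R) g :
  measurable_fun setT X1 -> measurable_fun setT h1 ->
  measurable_fun setT X2 -> measurable_fun setT h2 -> measurable_fun setT g ->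
  (forall s, 0 <= h1 s) -> (forall s, 0 <= h2 s) -> (forall x, 0 <= g x) ->
  (forall A, measurable A ->
     \int[mu1]_s (\1_A (X1 s) * h1 s)%:E =
     \int[mu2]_s (\1_A (X2 s) * h2 s)%:E)%E ->
  (\int[mu1]_s (g (X1 s) * h1 s)%:E = \int[mu2]_s (g (X2 s) * h2 s)%:E)%E.
Proof.
move=> mX1 mh1 mX2 mh2 mg h10 h20 g0 h12.
rewrite (integral_comp_mul_lim mu1 X1 h1 g mg)//.
rewrite (integral_comp_mul_lim mu2 X2 h2 g mg)//.
congr (limn _); apply/funext => m.
by apply: eq_fsbigr => y _; rewrite h12.
Qed.

End CompMul.

(** * Product of expectations under independence *)

Section Independence.
Context {R : realType} {d0 : measure_display} {S : measurableType d0}.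
Context (P : probability S R).

Lemma integral_indic_comp (X : {RV P >-> R}) (A : set R) : measurable A ->
  (\int[P]_s (\1_A (X s))%:E = P (X @^-1` A))%E.
Proof.
move=> mA; rewrite -[X @^-1` A]setIT -integral_indic//.
by rewrite -[X @^-1` A]setTI; exact: measurable_funPT.
Qed.

Context {I : finType} (X : I -> {RV P >-> R}).
Hypothesis indepX : mutually_independent X.

(* Indicators are replaced by general functions one index at a time. *)
Let integral_prod_seq (s : seq I) (g : I -> R -> R) (m : I -> R) :
  (forall i, measurable_fun setT (g i)) -> (forall i x, 0 <= g i x) ->
  (forall i, \int[P]_t (g i (X i t))%:E = (m i)%:E)%E ->
  (forall i, i \notin s -> exists2 A, measurable A & g i = \1_A) ->
  (\int[P]_t (\prod_i g i (X i t))%:E = (\prod_i m i)%:E)%E.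
Proof.
elim: s g m => [|j s IHs] g m mg g0 gm gs.
  (* With no index left, all factors are indicators; their product is the indicator of an
     intersection, and independence applies with the full index set. *)
  have /choice[A /all_and2[mA gA]] : forall i, exists A, measurable A /\ g i = \1_A.
    by move=> i; have [//|A] := gs i; exists A.
  rewrite -prodEFin; under [RHS]eq_bigr do rewrite -gm gA integral_indic_comp//.
  rewrite (eq_bigl (fun i => i \in [set: I]%SET)); last first.
    by move=> i; rewrite finset.in_setT.
  rewrite -indepX//.
  have mX : measurable (\bigcap_(i in [set` [set: I]%SET]) (X i @^-1` A i)).
    apply: fin_bigcap_measurable => // i _; rewrite -[X i @^-1` _]setTI.
    exact: measurable_funPT.
  rewrite -[X in P X]setIT -integral_indic//; apply: eq_integral => t _.
  congr EFin; under eq_bigr do rewrite gA.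
  have [tX|tX] := boolP [forall i, X i t \in A i].
    rewrite indicE mem_set => [|i _]; last by have /forallP/(_ i)/[!inE] := tX.
    by rewrite big1// => i _; rewrite indicE (forallP tX).
  have /forallPn[i itX] := tX.
  rewrite (bigD1 i)//= indicE (negbTE itX) mul0r indicE memNset// => /(_ i).
  by move=> itA; move: itX; rewrite mem_set//; apply: itA; rewrite /= finset.in_setT.
pose h t := \prod_(i | i != j) g i (X i t); pose c := \prod_(i | i != j) m i.
have mg_comp i : measurable_fun setT (fun t => g i (X i t)).
  exact: (measurableT_comp (mg i) (measurable_funPT (X i))).
have mh : measurable_fun setT h.
  by rewrite /h; under eq_fun do rewrite -big_filter; exact: measurable_prod.
have h0 t : 0 <= h t by exact: prodr_ge0.
have m0 i : 0 <= m i.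
  by rewrite -lee_fin -gm integral_ge0// => t _; rewrite lee_fin.
have c0 : 0 <= c by exact: prodr_ge0.
(* With an indicator in place of [g j] the induction hypothesis applies: [h] integrates like the
   constant [c] over every event that [X j] lies in [A]. *)
have hE A : measurable A ->
    (\int[P]_t (\1_A (X j t) * h t)%:E = \int[P]_t (\1_A (X j t) * c)%:E)%E.
  move=> mA.
  have mXA : (\int[P]_t (\1_A (X j t))%:E = (fine (P (X j @^-1` A)))%:E)%E.
    rewrite integral_indic_comp// fineK// fin_num_measure// -[X j @^-1` _]setTI.
    exact: measurable_funPT.
  pose g' i := if i == j then \1_A else g i.
  pose m' i := if i == j then fine (P (X j @^-1` A)) else m i.
  transitivity (\int[P]_t (\prod_i g' i (X i t))%:E)%E.
    apply: eq_integral => t _; rewrite (bigD1 j)//= {1}/g' eqxx.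
    by congr (_ * _)%:E; apply: eq_bigr => i /negbTE ij; rewrite /g' ij.
  rewrite (IHs g' m'); first 1 last.
  - by move=> i; rewrite /g'; case: ifP.
  - by move=> i x; rewrite /g'; case: ifP.
  - by move=> i; rewrite /g' /m'; case: eqP => // ->.
  - move=> i iNs; rewrite /g'; case: eqP => [_|/eqP ij]; first by exists A.
    by apply: gs; rewrite inE negb_or ij.
  under [RHS]eq_integral do rewrite mulrC EFinM.
  rewrite ge0_integralZl//; last first.
    apply/measurable_EFinP; apply: (measurableT_comp _ (measurable_funPT (X j))).
    exact: measurable_indic.
  rewrite mXA (bigD1 j)//= /m' eqxx mulrC EFinM; congr (_%:E * _)%E.
  by apply: eq_bigr => i /negbTE ->.
transitivity (\int[P]_t (g j (X j t) * h t)%:E)%E.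
  by apply: eq_integral => t _; rewrite (bigD1 j).
(* Agreement on indicators extends to [g j], so [h] may be replaced by [c]. *)
rewrite (eq_integral_comp_mul P P (X j) h (X j) (cst c))//.
under eq_integral do rewrite mulrC EFinM.
rewrite -[LHS]/(\int[P]_t (c%:E * (g j (X j t))%:E))%E ge0_integralZl//; last 2 first.
- exact/measurable_EFinP.
- by move=> t _; rewrite lee_fin.
by rewrite gm (bigD1 j)//= mulrC.
Qed.

(** Starting from the list of all indices makes the indicator condition vacuous. *)
Lemma independent_integral_prod (g : I -> R -> R) (m : I -> R) :
  (forall i, measurable_fun setT (g i)) -> (forall i x, 0 <= g i x) ->
  (forall i, \int[P]_t (g i (X i t))%:E = (m i)%:E)%E ->
  (\int[P]_t (\prod_i g i (X i t))%:E = (\prod_i m i)%:E)%E.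
Proof.
move=> mg g0 gm; apply: (integral_prod_seq (enum I)) => // i.
by rewrite mem_enum.
Qed.

End Independence.

(** * Chi-square tail from an exponential moment *)

Section NormalTail.
Context {R : realType} {d0 : measure_display} {S : measurableType d0}.
Context (P : probability S R).

(** The density is the weight on the Lebesgue side, against weight [1] on the probability side; on
    indicators the equality is the assumed law of [Z]. *)
Lemma integral_comp_normal (Z : {RV P >-> R}) (m sigma : R) (g : R -> R) :
  sigma != 0 ->
  (forall A, measurable A -> distribution P Z A = normal_prob m sigma A) ->
  measurable_fun setT g -> (forall x, 0 <= g x) ->
  (\int[P]_s (g (Z s))%:E =
   \int[lebesgue_measure]_x (g x * normal_pdf m sigma x)%:E)%E.
Proof.
move=> s0 PZ mg g0.
transitivity (\int[P]_s (g (Z s) * cst 1 s)%:E)%E.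
  by under [RHS]eq_integral do rewrite mulr1.
apply: (eq_integral_comp_mul P lebesgue_measure Z (cst 1) id) => //.
- exact: measurable_normal_pdf.
- by move=> x; exact: normal_pdf_ge0.
move=> A mA; under eq_integral do rewrite mulr1.
rewrite integral_indic_comp// -[LHS]/(distribution P Z A) PZ//.
rewrite /normal_prob [LHS]integral_mkcond; apply: eq_integral => x _.
by rewrite patchE indicE; case: ifPn => _; rewrite ?mul1r ?mul0r.
Qed.

Lemma integral_expR_sqr_normal (Z : {RV P >-> R}) (sigma : R) :
  0 < sigma ->
  (forall A, measurable A -> distribution P Z A = normal_prob 0 sigma A) ->
  (\int[P]_s (expR (3 / (8 * sigma ^+ 2) * Z s ^+ 2))%:E = 2%:E)%E.
Proof.
move=> s0 PZ.
rewrite (integral_comp_normal Z 0 sigma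
  (fun x => expR (3 / (8 * sigma ^+ 2) * x ^+ 2)))//; last 2 first.
- by rewrite gt_eqF.
- by apply: measurableT_comp => //; exact: measurable_funM.
(* In units of [x^2 / sigma^2] the exponent is [3/8 - 1/2 = - 1/8], that of a Gaussian of deviation
   [2 * sigma]; its peak is half as high, whence the factor [2]. *)
transitivity (\int[lebesgue_measure]_x
    (2%:E * (normal_pdf 0 (2 * sigma) x)%:E) : \bar R)%E.
  apply: eq_integral => x _; rewrite -EFinM; congr EFin.
  rewrite !normal_pdfE ?gt_eqF ?mulr_gt0// /normal_peak /normal_fun subr0.
  have -> : (2 * sigma) ^+ 2 * pi *+ 2 = 2 ^+ 2 * (sigma ^+ 2 * pi *+ 2) by ring.
  rewrite sqrtrM// sqrtr_sqr ger0_norm// mulrCA -expRD.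
  rewrite [RHS]mulrA (invfM 2) (mulrA 2) divff// mul1r; congr (_ * expR _).
  by field; rewrite ?gt_eqF.
rewrite ge0_integralZl//.
- by rewrite integral_normal_pdf ?mule1// gt_eqF ?mulr_gt0.
- by apply/measurable_EFinP; exact: measurable_normal_pdf.
- by move=> x _; rewrite lee_fin normal_pdf_ge0.
Qed.

Context {I : finType} (Z : I -> {RV P >-> R}) (sigma : R) (D : {set I}).
Hypotheses (s0 : 0 < sigma) (Z_normal : iid_normal Z sigma).

Let Q s := \sum_(i in D) Z i s ^+ 2.

Lemma measurable_sum_sqr : measurable_fun setT Q.
Proof.
rewrite /Q; under eq_fun do rewrite -big_filter.
by apply: measurable_sum => i; exact: measurable_funX.
Qed.

Lemma mmt_gen_fun_sum_sqr :
  mmt_gen_fun P Q (3 / (8 * sigma ^+ 2)) = (2 ^+ #|D|)%:E.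
Proof.
have [indepZ PZ] := Z_normal.
(* Indices outside [D] get the constant factor [1], so that a product over all of [I] represents the
   sum over [D]. *)
pose g (i : I) x := if i \in D then expR (3 / (8 * sigma ^+ 2) * x ^+ 2) else 1.
rewrite /mmt_gen_fun unlock.
transitivity (\int[P]_s (\prod_i g i (Z i s))%:E)%E.
  apply: eq_integral => s _; rewrite -big_mkcond/= -expR_sum.
  by rewrite /= mulrC mulr_sumr.
rewrite (independent_integral_prod P Z indepZ g (fun i => if i \in D then 2 else 1)).
- by rewrite -big_mkcond/= prodr_const.
- move=> i; rewrite /g; case: (i \in D) => //.
  by apply: measurableT_comp => //; exact: measurable_funM.
- by move=> i x; rewrite /g; case: ifP => _; rewrite ?expR_ge0.
- move=> i; rewrite /g; case: ifP => _; first by apply: integral_expR_sqr_normal s0 _ => A; exact: PZ.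
  by rewrite integral_cst//= mul1e probability_setT.
Qed.

Let tail : set S := [set s | 4 * sigma ^+ 2 * (#|D|%:R * ln 2) <= Q s].

Lemma sum_sqr_normal_tail :
  measurable tail /\ (P tail <= (2 `^ (- (#|D|%:R / 2)))%:E)%E.
Proof.
have mQ := measurable_sum_sqr; split.
  by rewrite /tail -[X in measurable X]setTI; exact: measurable_fun_le.
pose mQ_mixin := isMeasurableFun.Build _ _ _ _ Q mQ.
pose X : {mfun S >-> R} := HB.pack Q mQ_mixin.
have l0 : 0 < 3 / (8 * sigma ^+ 2) by rewrite divr_gt0// mulr_gt0// exprn_gt0.
apply: (le_trans (chernoff X _ l0)).
rewrite -[mmt_gen_fun _ _ _]/(mmt_gen_fun P Q _) mmt_gen_fun_sum_sqr.
have powE x : 2 `^ x = expR (x * ln 2) :> R by rewrite /powR pnatr_eq0.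
(* With [m = #|D|], the exponents satisfy [m ln 2 - (3/2) m ln 2 = - (m/2) ln 2]: the bound holds
   with equality. *)
rewrite -EFinM lee_fin -(powR_mulrn #|D| (ler0n _ 2)) !powE -expRD ler_expR le_eqVlt.
by apply/orP; left; apply/eqP; field; rewrite gt_eqF.
Qed.

End NormalTail.

Theorem theorem3p1 (R : realType) (n : nat) (n_gt0 : (0 < n)%N)
    (d : 'I_n -> nat)
    (w : forall k : 'I_n, 'rV[R]_(d k)) (W : tensor R d)
    (W_outer : W = outer w) (W_gt0 : forall i : index d, 0 < W i)
    (Omega : {set index d}) (Omega_neq0 : Omega != finset.set0)
    (T : tensor R d) (sigma : R) (sigma_gt0 : 0 < sigma)
    (d0 : measure_display) (S : measurableType d0) (P : probability S R)
    (Z : index d -> {RV P >-> R}) (Z_normal : iid_normal Z sigma)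
    (Y : S -> tensor R d)
    (Y_def : forall s : S, Y s = hadamard (tindic Omega) (T + sample Z s))
    (r : nat) (rs : {ffun 'I_n -> nat}) (C : set (tensor R d))
    (situation :
       (has_cp_rank T r /\ C = [set X | has_cp_rank X r]) \/
       (tucker_rank T = rs /\ C = [set X | tucker_rank X = rs])) :
  exists E : set S,
    [/\ measurable E,
        ((1 - 2 `^ (- (#|Omega|%:R / 2)))%:E <= P E)%E &
        forall s : S, E s ->
        forall That : tensor R d, optimal_solution W (Y s) C That ->
          fnorm (hadamard (tpow W 2^-1) (T - That)) <=
            2 * supnorm T *
              fnorm (tpow W 2^-1 - hadamard (tpow W (- 2^-1)) (tindic Omega))
            + 4 * sigma * mu W Omega * Num.sqrt (#|Omega|%:R * ln 2)].
Proof.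
have CT : C (hadamard (tpow W 2^-1) T).
  rewrite W_outer in W_gt0 *.
  case: situation => -[Trank ->]/=; first exact: has_cp_rank_tpow_outer.
  by rewrite tucker_rank_tpow_outer.
have [mtail Ptail] := sum_sqr_normal_tail P Z sigma Omega sigma_gt0 Z_normal.
set tail := [set s | _] in mtail Ptail.
(* The event depends on the noise alone, so the bound holds there for all optimal solutions at
   once. *)
exists (~` tail); split; first exact: measurableC.
  by rewrite probability_setC// EFinB leeB.
move=> s /negP; rewrite -ltNge => sQ That.
rewrite Y_def => /(optimal_solution_fnorm_le _ _ _ _ _ _ W_gt0 CT) /le_trans; apply.
rewrite lerD2l.
(* In [4 = 2 * 2], one factor comes from the comparison with a competitor, the other from the square
   root of the threshold [4 * sigma ^+ 2 * (#|Omega|%:R * ln 2)]. *)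
have -> : 4 * sigma * mu W Omega * Num.sqrt (#|Omega|%:R * ln 2) =
    2 * mu W Omega * (2 * sigma * Num.sqrt (#|Omega|%:R * ln 2)) by ring.
rewrite ler_wpM2l ?mulr_ge0 ?sqrtr_ge0//.
rewrite -[2 * sigma]gtr0_norm ?mulr_gt0// -sqrtr_sqr -sqrtrM ?sqr_ge0//.
rewrite /fnorm ler_wsqrtr//.
apply: le_trans (_ : \sum_(i in Omega) Z i s ^+ 2 <= _); last first.
  by rewrite exprMn -natrX ltW.
rewrite [leRHS]big_mkcond ler_sum// => i _; rewrite !ffunE.
by case: (i \in Omega); rewrite ?mul1r// mul0r expr0n.
Qed.
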